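(* Let $W$ be an irreducible euclidean Coxeter group that is not of type $\widetilde A_n$, let $w$ be a Coxeter element of $W$, let $L$ be the axis of $w$, and let $\sigma$ be a chamber of the Coxeter complex of $W$. Then $\sigma$ produces $w$ as a bipartite Coxeter element if and only if the line $L$ intersects the interior of $\sigma$.
   Context: $W$ is the group generated by the reflections of an $n$-dimensional euclidean space $E$ in the facets of a euclidean $n$-simplex with dihedral angles submultiples of $\pi$, acting properly and cocompactly; its Coxeter diagram $\Gamma$ is an extended Dynkin diagram, which (since the type is not $\widetilde A_n$) is a tree. The images of the simplex under $W$ are the chambers; they form the Coxeter complex, and $W$ acts simply transitively on chambers, which canonically identifies the reflections in the facets of any chamber with the vertices of $\Gamma$. A Coxeter element is a product of the reflections in the facets of some chamber in some order. Any Coxeter element $w$ is a hyperbolic isometry (no fixed points) and its min-set (the set of points of $E$ moved the minimal distance by $w$) is a line, called the axis of $w$. For a chamber $\sigma$, the tree $\Gamma$ has a unique bipartition, giving a partition $S_\sigma=S_0\sqcup S_1$ of the reflections in the facets of $\sigma$ into two sets of pairwise commuting reflections; let $w_j$ be the product of the reflections in $S_j$. The chamber $\sigma$ produces $w$ as a bipartite Coxeter element if $w=w_1w_0$ or $w=w_0w_1$. *)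

(* Defs.v *)
From HB Require Import structures.
From mathcomp Require Import all_boot all_order all_algebra all_fingroup.
From mathcomp Require Import all_classical all_reals all_analysis.

Set Implicit Arguments.
Unset Strict Implicit.
Unset Printing Implicit Defensive.

Import Order.TTheory GRing.Theory Num.Theory.
Local Open Scope ring_scope.

Section Coxeter.
Variables (R : realType) (n : nat).

Definition dot (u v : 'rV[R]_n) : R := (u *m v^T) 0 0.

Definition refl (a : 'rV[R]_n) (b : R) (x : 'rV[R]_n) : 'rV[R]_n :=
  x - ((2 * (dot x a - b)) / dot a a) *: a.

(* The simplex sigma = {x | forall i, dot x (a i) <= b i}: facet i lies in the
   hyperplane dot x (a i) = b i and a i is its outward normal. *)
Definition closed_simplex (a : 'I_n.+1 -> 'rV[R]_n) (b : 'I_n.+1 -> R)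
  (x : 'rV[R]_n) : Prop := forall i, dot x (a i) <= b i.
Definition open_simplex (a : 'I_n.+1 -> 'rV[R]_n) (b : 'I_n.+1 -> R)
  (x : 'rV[R]_n) : Prop := forall i, dot x (a i) < b i.

(* The n+1 half-spaces cut out a (bounded, non-degenerate) n-simplex:
   any n of the normals are linearly independent, the normals satisfy a
   positive linear relation (boundedness), and the interior is nonempty. *)
Definition is_simplex (a : 'I_n.+1 -> 'rV[R]_n) (b : 'I_n.+1 -> R) : Prop :=
  [/\ forall i : 'I_n.+1, row_free (\matrix_(k < n) a (lift i k)),
      exists lam : 'I_n.+1 -> R, (forall i, 0 < lam i) /\
                                 \sum_i lam i *: a i = 0
    & exists x, open_simplex a b x].

Definition word_eval (a : 'I_n.+1 -> 'rV[R]_n) (b : 'I_n.+1 -> R)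
  (u : seq 'I_n.+1) : 'rV[R]_n -> 'rV[R]_n :=
  foldr (fun i f => refl (a i) (b i) \o f) id u.

(* The chamber g(sigma), g = word_eval u, has the reflection g s_i g^-1 in its
   i-th facet (g^-1 = word_eval (rev u) since reflections are involutions). *)
Definition facet_refl a b (u : seq 'I_n.+1) (i : 'I_n.+1) :
  'rV[R]_n -> 'rV[R]_n :=
  word_eval a b u \o refl (a i) (b i) \o word_eval a b (rev u).

Definition chamber_interior a b (u : seq 'I_n.+1) (x : 'rV[R]_n) : Prop :=
  exists2 y, open_simplex a b y & x = word_eval a b u y.

Definition is_coxeter_element a b (w : 'rV[R]_n -> 'rV[R]_n) : Prop :=
  exists (u : seq 'I_n.+1) (p : {perm 'I_n.+1}),
    w = foldr (fun k f => facet_refl a b u (p k) \o f) id (enum 'I_n.+1).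

Definition diagram (m : 'I_n.+1 -> 'I_n.+1 -> nat) : rel 'I_n.+1 :=
  fun i j => (i != j) && (3 <= m i j)%N.

Definition is_tree (e : rel 'I_n.+1) : Prop :=
  (forall i j, connect e i j) /\
  ~ (exists s : seq 'I_n.+1, [/\ uniq s, (3 <= size s)%N & path.cycle e s]).

(* Product of the (pairwise commuting) reflections in the facets of chamber u
   whose vertex has colour j. *)
Definition color_prod a b (u : seq 'I_n.+1) (c : 'I_n.+1 -> bool) (j : bool) :
  'rV[R]_n -> 'rV[R]_n :=
  foldr (fun i f => facet_refl a b u i \o f) id
        [seq i <- enum 'I_n.+1 | c i == j].

(* Chamber u produces w as a bipartite Coxeter element: with S_0, S_1 the
   bipartition of the tree diagram (a proper 2-colouring c), w = w1 w0 or
   w = w0 w1. *)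
Definition produces_bipartite a b m (u : seq 'I_n.+1)
  (w : 'rV[R]_n -> 'rV[R]_n) : Prop :=
  exists c : 'I_n.+1 -> bool,
    (forall i j, diagram m i j -> c i != c j) /\
    (w = color_prod a b u c true \o color_prod a b u c false \/
     w = color_prod a b u c false \o color_prod a b u c true).

Definition min_set (w : 'rV[R]_n -> 'rV[R]_n) (x : 'rV[R]_n) : Prop :=
  forall y, dot (w x - x) (w x - x) <= dot (w y - y) (w y - y).

End Coxeter.

(* Main.v *)
Require Import Defs.
From HB Require Import structures.
From mathcomp Require Import all_boot all_order all_algebra all_fingroup.
From mathcomp Require Import all_classical all_reals all_analysis.
From mathcomp Require Import ring lra.
Import Order.TTheory GRing.Theory Num.Theory.
Local Open Scope ring_scope.

Set Implicit Arguments.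
Unset Strict Implicit.
Unset Printing Implicit Defensive.

(* Write f_i for the distance to facet i and lam for the positive linear
   relation between the unit normals. For a bipartite w = w1 w0 the vector
   v = sum_{S0} lam_i a_i = - sum_{S1} lam_j a_j spans the intersection of the
   spans of the two halves, and the axis is the line of points P(t) with
   f_i = (r - t) lam_i on S0 and f_j = (r + t) lam_j on S1, where r > 0.
   It crosses the open chamber exactly for |t| < r, and w0, w1 act on it as the
   point reflections t -> 2r - t and t -> -2r - t.
   Conversely, on a tree any two orderings of the vertices are related by
   rotations and swaps of commuting neighbours, so that w is produced
   bipartitely by some chamber. The group <w0, w1> folds any point of the axis
   into the closure of that chamber; as W acts simply transitively on chambers,
   a chamber whose interior meets the axis is a translate by an element of
   <w0, w1>, which conjugates w1 w0 to itself or to w0 w1. *)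

(** * Orderings of the vertices of a forest *)

Section Forest.
Variables (T : eqType) (e : rel T).
Hypotheses (e_sym : symmetric e) (e_irr : irreflexive e).
Hypothesis acyclic : ~ (exists s, [/\ uniq s, (3 <= size s)%N & path.cycle e s]).

(** An endpoint of a longest simple path works: a further neighbour would either lengthen the path
    or close a cycle. *)
Lemma exists_leaf (S : seq T) : uniq S -> S != [::] ->
  exists2 v, v \in S & (count (e v) S <= 1)%N.
Proof.
move=> uS; case: S uS => // z0 S0; set S := z0 :: S0 => uS _.
pose P k := `[< exists t, [/\ size t = k, uniq t, {subset t <= S} & sorted e t] >].
have P1 : P 1%N.
  apply/asboolP; exists [:: z0]; split=> // y.
  by rewrite !inE => /eqP ->; rewrite eqxx.
have exP : exists k, P k by exists 1%N.
have ubP k : P k -> (k <= size S)%N.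
  by move=> /asboolP [t [<- ut tS _]]; apply: uniq_leq_size.
case: (ex_maxnP exP ubP) => k /asboolP [t [szt ut tS pt]] maxk.
case: t szt ut tS pt => [|x p] szt ut tS pt.
  by have := maxk _ P1; rewrite -szt.
exists x; first by apply: tS; rewrite mem_head.
(* The second vertex of the path is the only possible neighbour. For a one-vertex path the default
   [x] of [head] is harmless, since no neighbour remains. *)
rewrite -size_filter; apply: (@leq_trans (size [:: head x p])) => //.
apply: uniq_leq_size; first exact: filter_uniq.
move=> y; rewrite mem_filter inE => /andP [exy yS].
have yp : y \in p.
  apply: contraT => ynp.
  suff /maxk : P k.+1 by rewrite ltnn.
  apply/asboolP; exists (y :: x :: p); split.
  - by rewrite -szt.
  - rewrite cons_uniq ut andbT inE negb_or ynp andbT.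
    by apply: contraTneq exy => ->; rewrite e_irr.
  - by move=> z; rewrite inE => /predU1P [-> //|]; apply: tS.
  - by rewrite /= e_sym exy.
case: p szt ut tS pt yp => //= p1 p _ ut _ pt.
rewrite inE => /predU1P [-> //|] /splitPr yp.
case: yp ut pt => q1 q2 ut pt; case: acyclic.
(* A neighbour [y] beyond [p1] closes the initial segment of the path into a cycle. *)
exists (x :: p1 :: rcons q1 y); split.
- move: ut; rewrite -cat_rcons => ut.
  have : uniq ((x :: p1 :: rcons q1 y) ++ q2) by [].
  by rewrite cat_uniq => /andP [].
- by rewrite /= size_rcons.
- rewrite /= rcons_path last_rcons [e y x]e_sym exy andbT.
  by move: pt; rewrite -cat_rcons cat_path => /and3P [-> -> _].
Qed.

Lemma exists_coloring (S : seq T) : uniq S ->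
  exists c : T -> bool, {in S &, forall i j, e i j -> c i != c j}.
Proof.
have [k] := ubnP (size S); elim: k S => // k IH S; rewrite ltnS => szS uS.
have [->|S0] := eqVneq S [::]; first by exists (fun=> true).
have [v vS leaf] := exists_leaf uS S0.
have [|c Hc] := IH (rem v S) _ (rem_uniq v uS).
  by rewrite size_rem //; case: (S) szS S0.
(* The leaf takes the colour opposite to that of its only neighbour, and [true] if it has none. *)
exists (fun i => if i == v then ~~ has (fun j => e v j && c j) S else c i).
have nb i : i \in S -> e v i -> has (fun j => e v j && c j) S = c i.
  move=> iS evi; apply/hasP/idP => [[j jS /andP [evj cj]]|ci]; last first.
    by exists i => //; rewrite evi.
  suff -> : i = j by [].
  apply: contraTeq leaf => ij; rewrite -ltnNge -size_filter.
  rewrite (@uniq_leq_size _ [:: i; j]) //= ?inE ?ij // => z.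
  by rewrite !inE mem_filter => /orP [] /eqP ->; apply/andP.
move=> i j iS jS eij.
have ij : i != j by apply: contraTneq eij => ->; rewrite e_irr.
case: (eqVneq i v) ij => [iv|iv] ij; case: (eqVneq j v) => jv.
- by move: ij; rewrite iv jv eqxx.
- by rewrite iv in eij; rewrite (nb j) //; case: (c j).
- by rewrite jv e_sym in eij; rewrite (nb i) //; case: (c i).
- by apply: Hc; rewrite // mem_rem_uniq // inE ?iv ?jv.
Qed.

(** Read as products of reflections, a swap of non-adjacent letters changes nothing and a rotation
    conjugates by the first letter. *)
Inductive cox_move : seq T -> seq T -> Prop :=
| cox_refl s : cox_move s s
| cox_trans s t r : cox_move s t -> cox_move t r -> cox_move s r
| cox_swap s x y t : ~~ e x y ->
    cox_move (s ++ x :: y :: t) (s ++ y :: x :: t)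
| cox_rot x s : cox_move (x :: s) (rcons s x).

Lemma cox_catC s t : cox_move (s ++ t) (t ++ s).
Proof.
elim: s t => [|x s IH] t; first by rewrite cats0; apply: cox_refl.
rewrite cat_cons; apply: cox_trans (cox_rot _ _) _.
by rewrite -cat_rcons -cats1 -catA cats1; apply: IH.
Qed.

Lemma cox_perm s t : cox_move s t -> perm_eq s t.
Proof.
elim=> [//|s1 s2 s3 _ H _|s1 x y s2 _|x s1].
- exact: perm_trans.
- by rewrite perm_cat2l -[x :: _]/([:: x] ++ [:: y] ++ s2) perm_catCA.
- by rewrite perm_sym perm_rcons.
Qed.

Lemma cox_pass p v s t : ~~ has (e v) s ->
  cox_move (p ++ s ++ v :: t) (p ++ v :: s ++ t).
Proof.
elim: s p t => [|x s IH] p t /=; first by move=> _; apply: cox_refl.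
rewrite negb_or => /andP [evx evs].
have := IH (rcons p x) t evs; rewrite !cat_rcons => IH1.
by apply: cox_trans IH1 _; apply: cox_swap; rewrite e_sym.
Qed.

(* Rotating the neighbour [x] of the leaf [v] past [v]:
   v x r ~ x r v = x v r ~ v r x. *)
Lemma cox_move_leaf v s t : cox_move s t -> (count (e v) s <= 1)%N ->
  cox_move (v :: s) (v :: t).
Proof.
elim=> {s t} [s|s t r st IH1 _ IH2|s x y t exy|x s] leaf.
- exact: cox_refl.
- apply: cox_trans (IH1 leaf) (IH2 _).
  by rewrite -(seq.permP (cox_perm st)).
- exact: (@cox_swap (v :: s)).
- apply: (@cox_trans _ (x :: v :: s)); last exact: (cox_rot x (v :: s)).
  case evx: (e v x); last by apply: (@cox_swap [::]); rewrite evx.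
  have evs : ~~ has (e v) s.
    by move: leaf; rewrite /= evx has_count; case: (count _ _).
  apply: (@cox_trans _ (x :: rcons s v)); first exact: (cox_rot v (x :: s)).
  by have := cox_pass [:: x] [::] evs; rewrite cats1 cats0.
Qed.

(** Induction on length: both words are rotated until they begin with the same leaf, and the moves
    between the two tails are lifted past it. *)
Lemma cox_move_perm s t : uniq s -> perm_eq s t -> cox_move s t.
Proof.
have [k] := ubnP (size s); elim: k s t => // k IH s t; rewrite ltnS => szs us st.
have [s0|s0] := eqVneq s [::].
  by move: st; rewrite s0 perm_sym => /perm_nilP ->; apply: cox_refl.
have [v vs leaf] := exists_leaf us s0.
have vt : v \in t by rewrite -(perm_mem st).
case/splitPr: vs us st szs leaf {s0} => s1 s2 us st szs leaf.
case/splitPr: vt st => t1 t2 st.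
apply: cox_trans (cox_catC s1 (v :: s2)) _.
apply: cox_trans (cox_catC (v :: t2) t1).
have st' : perm_eq (v :: s2 ++ s1) (v :: t2 ++ t1).
  by rewrite -!cat_cons perm_catC perm_sym perm_catC perm_sym.
rewrite !cat_cons; apply: cox_move_leaf; last first.
  by move: leaf; rewrite !count_cat /= e_irr addnC.
apply: IH; last by rewrite -(perm_cons v).
  by move: szs; rewrite !size_cat /= addnS addnC.
by move: us; rewrite uniq_catC => /andP [].
Qed.

End Forest.

(** * Reflection words *)

Section Words.
Variables (R : realType) (n : nat).
Variables (a : 'I_n.+1 -> 'rV[R]_n) (b : 'I_n.+1 -> R).
Hypothesis a_unit : forall i, dot (a i) (a i) = 1.

Lemma dotE (x y : 'rV[R]_n) : dot x y = \sum_k x 0 k * y 0 k.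
Proof. by rewrite /dot mxE; apply: eq_bigr => k _; rewrite mxE. Qed.

Lemma dotC (x y : 'rV[R]_n) : dot x y = dot y x.
Proof. by rewrite !dotE; apply: eq_bigr => k _; rewrite mulrC. Qed.

Lemma dotDl (x y z : 'rV[R]_n) : dot (x + y) z = dot x z + dot y z.
Proof. by rewrite /dot mulmxDl mxE. Qed.

Lemma dotZl k (x z : 'rV[R]_n) : dot (k *: x) z = k * dot x z.
Proof. by rewrite /dot -scalemxAl mxE. Qed.

Lemma dotNl (x z : 'rV[R]_n) : dot (- x) z = - dot x z.
Proof. by rewrite /dot mulNmx mxE. Qed.

Lemma dotBl (x y z : 'rV[R]_n) : dot (x - y) z = dot x z - dot y z.
Proof. by rewrite dotDl dotNl. Qed.

Lemma dotDr (x y z : 'rV[R]_n) : dot z (x + y) = dot z x + dot z y.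
Proof. by rewrite dotC dotDl !(dotC z). Qed.

Lemma dotZr k (x z : 'rV[R]_n) : dot z (k *: x) = k * dot z x.
Proof. by rewrite dotC dotZl (dotC z). Qed.

Lemma dotBr (x y z : 'rV[R]_n) : dot z (x - y) = dot z x - dot z y.
Proof. by rewrite dotC dotBl !(dotC z). Qed.

Lemma dot0l (z : 'rV[R]_n) : dot 0 z = 0.
Proof. by rewrite /dot mul0mx mxE. Qed.

Lemma dot_suml (I : Type) (r : seq I) (P : pred I) (F : I -> 'rV[R]_n) z :
  dot (\sum_(i <- r | P i) F i) z = \sum_(i <- r | P i) dot (F i) z.
Proof.
apply: (big_morph (fun x => dot x z)) => [x y|]; first exact: dotDl.
exact: dot0l.
Qed.

Lemma dot_ge0 (x : 'rV[R]_n) : 0 <= dot x x.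
Proof. by rewrite dotE; apply: sumr_ge0 => k _; rewrite -expr2 sqr_ge0. Qed.

Lemma dot_eq0 (x : 'rV[R]_n) : dot x x = 0 -> x = 0.
Proof.
rewrite dotE => /eqP; rewrite psumr_eq0; last by move=> k _; rewrite -expr2 sqr_ge0.
move=> /allP H; apply/rowP => k; rewrite mxE.
by have := H k (mem_index_enum _); rewrite /= mulf_eq0 orbb => /eqP.
Qed.

(** Signed distance to facet [i] when the normal is a unit vector, positive on the side of the
    simplex. *)
Definition height i (x : 'rV[R]_n) := b i - dot x (a i).
Notation f := height.

Notation W := (word_eval a b).

Lemma reflE i x : refl (a i) (b i) x = x + (2 * f i x) *: a i.
Proof. by rewrite /refl a_unit divr1 -scaleNr -mulrN opprB. Qed.

Lemma height_refl j i x :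
  f j (refl (a i) (b i) x) = f j x - 2 * f i x * dot (a i) (a j).
Proof. by rewrite reflE /f dotDl dotZl; ring. Qed.

Lemma height_refl_id i x : f i (refl (a i) (b i) x) = - f i x.
Proof. by rewrite height_refl a_unit; ring. Qed.

Lemma reflK i : involutive (refl (a i) (b i)).
Proof.
move=> x; rewrite !reflE -addrA -scalerDl.
have := height_refl_id i x; rewrite reflE => ->.
by rewrite mulrN subrr scale0r addr0.
Qed.

Lemma refl_isometry i x y :
  dot (refl (a i) (b i) x - refl (a i) (b i) y)
      (refl (a i) (b i) x - refl (a i) (b i) y) = dot (x - y) (x - y).
Proof.
rewrite !reflE.
have -> : x + (2 * f i x) *: a i - (y + (2 * f i y) *: a i) =
          (x - y) - (2 * dot (x - y) (a i)) *: a i.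
  rewrite opprD addrACA; congr (_ + _).
  rewrite -scalerBl -[RHS]scaleNr; congr (_ *: _).
  by rewrite /f dotBl; ring.
move: (x - y) => z.
by rewrite !(dotBl, dotBr, dotZl, dotZr) a_unit (dotC (a i) z); ring.
Qed.

Lemma word_cat u v x : W (u ++ v) x = W u (W v x).
Proof. by elim: u => //= i u ->. Qed.

Lemma word_rcons u i x : W (rcons u i) x = W u (refl (a i) (b i) x).
Proof. by rewrite -cats1 word_cat. Qed.

Lemma word_revK u : cancel (W u) (W (rev u)).
Proof.
elim: u => //= i u IH x; rewrite rev_cons word_rcons /=.
by rewrite reflK IH.
Qed.

Lemma word_Krev u : cancel (W (rev u)) (W u).
Proof. by move=> x; rewrite -{1}(revK u) word_revK. Qed.

Lemma word_isometry u x y :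
  dot (W u x - W u y) (W u x - W u y) = dot (x - y) (x - y).
Proof. by elim: u => //= i u IH; rewrite refl_isometry. Qed.

(** The conjugating words cancel between consecutive factors, which reduces every chamber to the
    base chamber. *)
Lemma facet_word u s x :
  foldr (fun i g => facet_refl a b u i \o g) id s x = W u (W s (W (rev u) x)).
Proof.
elim: s => [|i s IH] /=; first by rewrite word_Krev.
by rewrite IH /facet_refl /= word_revK.
Qed.

Lemma color_prodE u c j x : color_prod a b u c j x =
  W u (W [seq i <- enum 'I_n.+1 | c i == j] (W (rev u) x)).
Proof. exact: facet_word. Qed.

Lemma min_set_conj u g y :
  min_set (fun x => W u (g (W (rev u) x))) (W u y) <-> min_set g y.
Proof.
split=> miny z.
  by have := miny (W u z); rewrite !word_revK !word_isometry.
by rewrite -[z](word_Krev u) !word_revK !word_isometry.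
Qed.

Definition orth_seq (s : seq 'I_n.+1) :=
  {in s &, forall i j, i != j -> dot (a i) (a j) = 0}.

(** Each reflection preserves the heights over the other, orthogonal facets, so the displacements
    add up. *)
Lemma word_orth s x : uniq s -> orth_seq s ->
  W s x = x + 2 *: \sum_(i <- s) f i x *: a i.
Proof.
elim: s => [|i s IH] /=; first by rewrite big_nil scaler0 addr0.
move=> /andP [ins us] os; rewrite big_cons reflE IH //; last first.
  by move=> j k js ks; apply: os; rewrite inE ?js ?ks orbT.
suff -> : f i (x + 2 *: \sum_(j <- s) f j x *: a j) = f i x.
  by rewrite scalerDr scalerA addrAC addrA.
rewrite /f dotDl dotZl dot_suml big_seq big1 ?mulr0 ?addr0 // => j js.
rewrite dotZl os ?mulr0 ?inE ?js ?eqxx ?orbT //.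
by apply: contraNneq ins => <-.
Qed.

Lemma orth_sum s j (g : 'I_n.+1 -> R) : uniq s -> orth_seq s -> j \in s ->
  dot (\sum_(i <- s) g i *: a i) (a j) = g j.
Proof.
move=> us os js; rewrite dot_suml (bigD1_seq j) //= dotZl a_unit mulr1.
rewrite big_seq_cond big1 ?addr0 // => i /andP [is_ ij].
by rewrite dotZl os ?mulr0.
Qed.

Lemma word_orthK s : uniq s -> orth_seq s -> involutive (W s).
Proof.
move=> us os x; rewrite (word_orth (W s x)) //.
rewrite [X in _ + 2 *: X](_ : _ = - \sum_(i <- s) f i x *: a i).
  by rewrite (word_orth x) // scalerN addrK.
rewrite -sumrN big_seq [RHS]big_seq; apply: eq_bigr => j js.
rewrite -scaleNr; congr (_ *: _).
by rewrite (word_orth x) // /f dotDl dotZl orth_sum // /f; ring.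
Qed.

(** The conjugator [h] is empty for a swap and a single letter for a rotation; along a chain of
    moves the conjugators are concatenated. *)
Lemma cox_move_conj (e : rel 'I_n.+1) s t :
  (forall i j, i != j -> ~~ e i j -> dot (a i) (a j) = 0) ->
  cox_move e s t -> exists h, forall x, W s (W h x) = W h (W t x).
Proof.
move=> he; elim=> {s t} [s|s t r _ [h Hh] _ [k Hk]|s x y t exy|i s].
- by exists [::].
- by exists (h ++ k) => x; rewrite !word_cat Hh Hk.
- exists [::] => z /=; rewrite !word_cat /=; congr (W s _).
  have [-> //|xy] := eqVneq x y.
  have d0 := he _ _ xy exy.
  rewrite [LHS]reflE [RHS]reflE !height_refl (dotC (a y)) d0 !mulr0 !subr0.
  by rewrite !reflE addrAC.
- by exists [:: i] => x; rewrite /= word_rcons.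
Qed.

End Words.

(** * Simple transitivity on chambers *)

Section SimpleTransitivity.
Variables (R : realType) (n : nat).
Variables (a : 'I_n.+1 -> 'rV[R]_n) (b : 'I_n.+1 -> R).
Variable m : 'I_n.+1 -> 'I_n.+1 -> nat.
Hypothesis a_unit : forall i, dot (a i) (a i) = 1.
Hypothesis a_angle : forall i j, i != j ->
  (2 <= m i j)%N /\ dot (a i) (a j) = - cos (pi / (m i j)%:R).

Notation W := (word_eval a b).
Notation f := (height a b).

Lemma sinS_rec (t : R) k :
  sin (k.+2%:R * t) = 2 * cos t * sin (k.+1%:R * t) - sin (k%:R * t).
Proof.
have -> : k.+2%:R * t = k.+1%:R * t + t by rewrite -[k.+2]addn1 natrD; ring.
have -> : k%:R * t = k.+1%:R * t - t by rewrite -[k.+1]addn1 natrD; ring.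
by rewrite sinD sinB; ring.
Qed.

Fixpoint alt (i j : 'I_n.+1) k := if k is k'.+1 then i :: alt j i k' else [::].

Lemma size_alt i j k : size (alt i j k) = k.
Proof. by elim: k i j => //= k IH i j; rewrite IH. Qed.

Lemma alt_prefix i j k l : exists r, alt i j (k + l) = alt i j k ++ r.
Proof.
elim: k i j => [|k IH] i j /=; first by exists (alt i j l).
by have [r ->] := IH j i; exists r.
Qed.

(** Both sides satisfy the Chebyshev recurrence of [sinS_rec]: peeling off the two outer reflections
    yields it for the heights. The factor [sin t] avoids a division. *)
Lemma height_alt (t : R) i j k x : dot (a i) (a j) = - cos t ->
  sin t * f i (W (alt j i k) x) =
  sin (k.+1%:R * t) * f (if odd k then j else i) x +
  sin (k%:R * t) * f (if odd k then i else j) x.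
Proof.
have [l] := ubnP k; elim: l k i j => // l IH k i j; rewrite ltnS.
move=> kl ct; have ct' : dot (a j) (a i) = - cos t by rewrite dotC.
case: k kl => [|[|k]] kl.
- by rewrite /= mul0r sin0 !mul1r; ring.
- by rewrite /= height_refl // ct' sinS_rec mul0r sin0 mul1r; ring.
- have IH1 := IH k.+1 j i kl ct'.
  have IH0 := IH k i j (ltnW kl) ct.
  have -> : f i (W (alt j i k.+2) x) =
      - f i (W (alt j i k) x) - 2 * f j (W (alt i j k.+1) x) * - cos t.
    by rewrite /= height_refl // ct' height_refl_id.
  have -> : sin t * (- f i (W (alt j i k) x) -
              2 * f j (W (alt i j k.+1) x) * - cos t) =
     2 * cos t * (sin t * f j (W (alt i j k.+1) x)) -
     sin t * f i (W (alt j i k) x) by ring.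
  rewrite IH1 IH0 !(sinS_rec t k.+1) !(sinS_rec t k) /=.
  by case: (odd k) => /=; ring.
Qed.

(** * Dihedral subgroups generated by two facet reflections *)

Section Dihedral.
Variables (i j : 'I_n.+1).
Hypothesis ij : i != j.
Let M := m i j.
Let t : R := pi / M%:R.

Let M_gt1 : (1 < M)%N. Proof. by case: (a_angle ij). Qed.

Let M_neq0 : M%:R != 0 :> R.
Proof. by rewrite pnatr_eq0; case: M M_gt1. Qed.

Let Mt : M%:R * t = pi. Proof. by rewrite /t mulrC divfK. Qed.

Let t_gt0 : 0 < t.
Proof. by rewrite /t divr_gt0 ?pi_gt0 // ltr0n; case: M M_gt1. Qed.

Let sin_mul_gt0 k : (0 < k < M)%N -> 0 < sin (k%:R * t).
Proof.
move=> /andP [k0 kM]; apply: sin_gt0_pi; rewrite -Mt.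
by rewrite mulr_gt0 ?ltr0n //= ltr_pM2r // ltr_nat.
Qed.

Let sint_gt0 : 0 < sin t.
Proof. by have := @sin_mul_gt0 1; rewrite mul1r; apply; rewrite M_gt1. Qed.

Let cij : dot (a i) (a j) = - cos t. Proof. by case: (a_angle ij). Qed.
Let cji : dot (a j) (a i) = - cos t. Proof. by rewrite dotC. Qed.

(** For [k < M] both angles in [height_alt] lie between 0 and pi, so the two sines are nonnegative,
    and they never vanish together. *)
Lemma height_alt_gt0 k x : (k < M)%N -> 0 < f i x -> 0 < f j x ->
  0 < f i (W (alt j i k) x).
Proof.
move=> kM fi fj; rewrite -(pmulr_rgt0 _ sint_gt0) (height_alt _ _ cij).
have H (p q : R) : 0 < p -> 0 < q ->
    0 < sin (k.+1%:R * t) * p + sin (k%:R * t) * q.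
  move=> p0 q0; case: k kM => [|k] kM.
    by rewrite mul0r sin0 mul0r addr0 mul1r mulr_gt0.
  apply: ltr_wpDl; last by rewrite mulr_gt0 // sin_mul_gt0.
  rewrite mulr_ge0 ?(ltW p0) //; case: (ltngtP k.+2 M) kM => // [kM _|-> _].
    by rewrite ltW // sin_mul_gt0.
  by rewrite Mt sinpi.
by case: (odd k); apply: H.
Qed.

(** An alternating word of length [M] is the longest element of the dihedral group: it negates the
    two heights and, for odd [M], also exchanges them. *)
Lemma height_altM (p q : 'I_n.+1) x :
  ((p == i) && (q == j)) || ((p == j) && (q == i)) ->
  f p (W (alt q p M) x) = - f (if odd M then q else p) x /\
  f p (W (alt p q M) x) = - f (if odd M then q else p) x.
Proof.
move=> pq.
have cpq : dot (a p) (a q) = - cos t.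
  by case/orP: pq => /andP [/eqP -> /eqP ->].
have sne : sin t != 0 by rewrite gt_eqF.
split; apply: (mulfI sne).
  rewrite (height_alt _ _ cpq) Mt sinpi mul0r addr0.
  by rewrite -[M.+1]addn1 natrD mulrDl Mt mul1r addrC sinDpi; ring.
(* This word starts with [p] itself, so one reflection is removed before [height_alt] applies. *)
have [k Mk] : exists k, M = k.+1 by case: M M_gt1 => // k _; exists k.
rewrite Mk /= height_refl_id // mulrN (height_alt _ _ cpq) -Mk Mt sinpi mul0r add0r.
have -> : k%:R * t = pi - t by rewrite -Mt Mk -addn1 natrD; ring.
by rewrite sinB sinpi cospi; case: (odd k) => /=; ring.
Qed.

Lemma word_alt_span p q k x :
  ((p == i) && (q == j)) || ((p == j) && (q == i)) ->
  exists c d, W (alt p q k) x = x + c *: a i + d *: a j.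
Proof.
elim: k p q => [|k IH] p q pq.
  by exists 0, 0; rewrite !scale0r !addr0.
have [|c [d]] := IH q p; first by case/orP: pq => /andP [-> ->]; rewrite ?orbT.
rewrite /= => ->; rewrite reflE //; set s := 2 * _; move: s => s.
case/orP: pq => /andP [/eqP -> _].
  exists (s + c), d; rewrite scalerDl; move: (s *: _) (c *: _) (d *: _).
  by move=> u v w; rewrite [u + v]addrC !addrA [RHS]addrAC.
by exists c, (d + s); rewrite scalerDl !addrA.
Qed.

(* Both words translate [x] along the span of [a i] and [a j], so it is enough
   to compare heights. *)
Lemma braid x : W (alt i j M) x = W (alt j i M) x.
Proof.
have [|c [d e1]] := @word_alt_span i j M x; first by rewrite !eqxx.
have [|c' [d' e2]] := @word_alt_span j i M x; first by rewrite !eqxx orbT.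
have Hi : dot (W (alt i j M) x - W (alt j i M) x) (a i) = 0.
  have [|h1 h2] := @height_altM i j x; first by rewrite !eqxx.
  have : f i (W (alt j i M) x) = f i (W (alt i j M) x) by rewrite h1 h2.
  by rewrite /height dotBl => ?; lra.
have Hj : dot (W (alt i j M) x - W (alt j i M) x) (a j) = 0.
  have [|h1 h2] := @height_altM j i x; first by rewrite !eqxx orbT.
  have : f j (W (alt j i M) x) = f j (W (alt i j M) x) by rewrite h1 h2.
  by rewrite /height dotBl => ?; lra.
apply/eqP; rewrite -subr_eq0; apply/eqP; apply: dot_eq0.
have E : W (alt i j M) x - W (alt j i M) x = (c - c') *: a i + (d - d') *: a j.
  rewrite e1 e2 !scalerBl; move: (c *: _) (c' *: _) (d *: _) (d' *: _) => p q r s.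
  rewrite -[x + p + r]addrA -[x + q + s]addrA opprD addrACA subrr add0r opprD.
  by rewrite addrACA.
by rewrite [X in dot _ X]E dotDr !dotZr Hi Hj !mulr0 addr0.
Qed.

End Dihedral.

(** * Reduced words and the side of a facet on which a chamber lies *)

Definition shortest u := forall v, W v =1 W u -> (size u <= size v)%N.

Lemma shortest_exists u : exists2 v, W v =1 W u & shortest v.
Proof.
pose P k := `[< exists2 v, W v =1 W u & size v = k >].
have exP : exists k, P k by exists (size u); apply/asboolP; exists u.
case: (ex_minnP exP) => k /asboolP [v vu <-] mink; exists v => // v' v'v.
by apply: mink; apply/asboolP; exists v' => // x; rewrite v'v vu.
Qed.

Lemma shortest_cons j u : shortest (j :: u) -> shortest u.
Proof. by move=> H v vu; have := H (j :: v); apply => x /=; rewrite vu. Qed.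

(** A repeated letter would cancel, so a shortest word in two letters alternates. *)
Lemma shortest_alt i j p : {subset p <= [:: i; j]} -> shortest p ->
  ohead p != Some i -> p = alt j i (size p).
Proof.
elim: p i j => [|k p IH] i j //= sub sp hd.
have kj : k = j.
  have := sub k (mem_head _ _); rewrite !inE => /orP [] /eqP // ki.
  by move: hd; rewrite ki eqxx.
rewrite kj in sp sub *; congr (_ :: _); apply: IH.
- by move=> z zp; have := sub z; rewrite !inE zp orbT orbC; apply.
- exact: shortest_cons sp.
- apply/eqP; case: p sp {sub} => //= l p sp [lj].
  suff : false by []; have := sp p; rewrite lj /= ltnNge leqnSn; apply => // x /=.
  by rewrite reflK.
Qed.

(* If left multiplication by [i] does not shorten [u], the chamber of [u] lies
   on the same side of facet [i] as the base chamber: split [u = p q] with [p]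
   in the dihedral subgroup of [i] and [j], where [j] starts [u], and [q] as
   short as possible. *)
Lemma height_shortest_gt0 u i x : shortest u ->
  (forall v, W v =1 W (i :: u) -> (size u <= size v)%N) ->
  open_simplex a b x -> 0 < f i (W u x).
Proof.
have [l] := ubnP (size u); elim: l u i => // l IH u i; rewrite ltnS => ul su siu ox.
case: u ul su siu => [|j u'] ul su siu; first by rewrite subr_gt0; apply: ox.
set u := j :: u' in ul su siu *.
have ij : i != j.
  apply/eqP => ij; suff : false by [].
  have := siu u'; rewrite /u /= ltnn ij; apply => y /=.
  by rewrite reflK.
pose P k := `[< exists p q, [/\ {subset p <= [:: i; j]}, W (p ++ q) =1 W u,
                 (size p + size q = size u)%N & size q = k] >].
have exP : exists k, P k.
  by exists (size u); apply/asboolP; exists [::], u; split.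
(* Splitting off the first letter [j] is admissible, so the minimal [q] is shorter than [u] and the
   induction hypothesis covers it. *)
have Pu' : P (size u').
  by apply/asboolP; exists [:: j], u'; split=> // z; rewrite !inE => ->; rewrite orbT.
case: (ex_minnP exP) => k /asboolP [p [q [psub pq szpq <-]]] mink.
have ql : (size q < l)%N by apply: leq_ltn_trans (mink _ Pu') ul.
have pqu v : W v =1 W (p ++ q) -> (size u <= size v)%N.
  by move=> H; apply: su => y; rewrite H pq.
have sq : shortest q.
  move=> v vq; have := pqu (p ++ v); rewrite size_cat -szpq leq_add2l; apply => y.
  by rewrite !word_cat vq.
(* If [i] or [j] shortened [q] from the left, that letter could move over to [p], against the
   minimality of [q]. *)
have qk k' : k' \in [:: i; j] -> 0 < f k' (W q x).
  move=> k'in; apply: IH => // v vq; rewrite leqNgt; apply/negP => vsz.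
  have pkv : W (rcons p k' ++ v) =1 W (p ++ q).
    by move=> y; rewrite !word_cat word_rcons vq /= reflK.
  have := pqu _ pkv; rewrite size_cat size_rcons => sz.
  have : P (size v).
    apply/asboolP; exists (rcons p k'), v; split=> //.
    - by move=> z; rewrite mem_rcons inE => /predU1P [-> //|]; apply: psub.
    - by move=> y; rewrite pkv pq.
    - by apply/eqP; rewrite size_rcons eqn_leq sz andbT -szpq addSnnS leq_add2l.
  by move/mink; rewrite leqNgt vsz.
have sp : shortest p.
  move=> v vp; have := pqu (v ++ q); rewrite size_cat -szpq leq_add2r; apply => y.
  by rewrite !word_cat vp.
have sip v : W v =1 W (i :: p) -> (size p <= size v)%N.
  move=> vp; have := siu (v ++ q); rewrite size_cat -szpq leq_add2r; apply => y.
  by rewrite word_cat vp -[RHS]/(refl _ _ (W u y)) -pq word_cat.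
have palt : p = alt j i (size p).
  apply: shortest_alt => //; apply/eqP; case: p sip {psub pq szpq pqu sp qk} => //= i' p.
  move=> sip [ii']; suff : false by []; have := sip p; rewrite ii' ltnn; apply => y.
  by rewrite /= reflK.
(* Otherwise the braid relation lets [p] begin with [i], and left multiplication by [i] would
   shorten it. *)
have pM : (size p < m i j)%N.
  rewrite ltnNge; apply/negP => Mp.
  have [r pr] := alt_prefix j i (m i j) (size p - m i j).
  rewrite subnKC // -palt in pr.
  have [M' M'E] : exists M', m i j = M'.+1.
    by case: (a_angle ij); case: (m i j) => // M' _ _; exists M'.
  suff : false by []; have := sip (alt j i M' ++ r).
  have -> : size p = (M'.+1 + size r)%N by rewrite pr size_cat size_alt M'E.
  rewrite size_cat size_alt leq_add2r ltnn; apply => y.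
  by rewrite [RHS]/= pr !word_cat -braid // M'E /= reflK.
rewrite -pq word_cat palt.
by apply: height_alt_gt0 => //; apply: qk; rewrite !inE eqxx ?orbT.
Qed.

(** If a shortest word for the same isometry began with a letter [i], it would carry [x] strictly
    beyond facet [i]. *)
Lemma word_simply_transitive u x : open_simplex a b x ->
  closed_simplex a b (W u x) -> W u =1 id.
Proof.
move=> ox cx; have [[|i v] vu sv] := shortest_exists u; first by move=> y; rewrite -vu.
have := @height_shortest_gt0 v i x (shortest_cons sv) _ ox.
have H w : W w =1 W (i :: v) -> (size v <= size w)%N.
  by move=> wv; apply: ltnW; apply: sv.
move=> /(_ H) fv; have := cx i; rewrite -vu -subr_ge0.
by rewrite -[_ - _]/(f i (W (i :: v) x)) /= height_refl_id // oppr_ge0 leNgt fv.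
Qed.

End SimpleTransitivity.

(** * The axis of a bipartite Coxeter element *)

Section Axis.
Variables (R : realType) (n : nat).
Variables (a : 'I_n.+1 -> 'rV[R]_n) (b : 'I_n.+1 -> R).
Hypothesis a_unit : forall i, dot (a i) (a i) = 1.
Hypothesis a_free : forall i : 'I_n.+1, row_free (\matrix_(k < n) a (lift i k)).
Variable lam : 'I_n.+1 -> R.
Hypothesis lam_gt0 : forall i, 0 < lam i.
Hypothesis lam_rel : \sum_i lam i *: a i = 0.
Hypothesis interior : exists x, open_simplex a b x.

Notation W := (word_eval a b).
Notation f := (height a b).

Let M : 'M[R]_n := \matrix_(k < n) a (lift ord0 k).

Let mulmx_row_sum (r : 'rV[R]_n) : r *m M = \sum_k r 0 k *: a (lift ord0 k).
Proof.
rewrite mulmx_sum_row; apply: eq_bigr => k _; congr (_ *: _).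
by apply/rowP => j; rewrite !mxE.
Qed.

(** Subtracting the multiple of [lam] that kills the coefficient at [ord0] leaves a relation between
    linearly independent normals. *)
Lemma relation_unique (k : 'I_n.+1 -> R) : \sum_i k i *: a i = 0 ->
  exists kappa, forall i, k i = kappa * lam i.
Proof.
move=> k0; exists (k ord0 / lam ord0).
set kappa := k ord0 / lam ord0.
have l0 : lam ord0 != 0 by rewrite gt_eqF.
have : \sum_i (k i - kappa * lam i) *: a i = 0.
  under eq_bigr do rewrite scalerBl -scalerA.
  by rewrite sumrB k0 -scaler_sumr lam_rel scaler0 subr0.
rewrite big_ord_recl divfK // subrr scale0r add0r => H.
pose r : 'rV[R]_n := \row_j (k (lift ord0 j) - kappa * lam (lift ord0 j)).
have r0 : r = 0.
  apply/eqP; rewrite -(mulmx_free_eq0 _ (a_free ord0)) mulmx_row_sum.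
  by apply/eqP; rewrite -[RHS]H; apply: eq_bigr => j _; rewrite mxE.
move=> i; case: (unliftP ord0 i) => [j ->|->]; last by rewrite divfK.
by apply/eqP; rewrite -subr_eq0; move/rowP/(_ j): r0; rewrite !mxE => ->.
Qed.

Let sum_lam_dot x : \sum_i lam i * dot x (a i) = 0.
Proof.
have E : dot (\sum_i lam i *: a i) x = 0 by rewrite lam_rel dot0l.
by rewrite -[RHS]E dot_suml; apply: eq_bigr => k _; rewrite dotZl dotC.
Qed.

(** The values on [n] independent normals can be prescribed freely; the linear relation then forces
    the remaining one. *)
Lemma dot_solve (r : 'I_n.+1 -> R) : \sum_i lam i * r i = 0 ->
  exists x, forall i, dot x (a i) = r i.
Proof.
move=> lr0; have uM : M^T \in unitmx by rewrite unitmx_tr -row_free_unit a_free.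
pose r' : 'rV[R]_n := \row_j r (lift ord0 j).
have [x xM] : exists x, x *m M^T = r' by exists (r' *m invmx M^T); rewrite mulmxKV.
exists x.
have xl j : dot x (a (lift ord0 j)) = r (lift ord0 j).
  have : (x *m M^T) 0 j = r (lift ord0 j) by rewrite xM mxE.
  move=> <-; rewrite dotE mxE; apply: eq_bigr => k _.
  by rewrite !mxE.
move=> i; case: (unliftP ord0 i) => [j ->//|->].
have l0 : lam ord0 != 0 by rewrite gt_eqF.
apply: (mulfI l0); have := sum_lam_dot x.
rewrite -[RHS]lr0 !big_ord_recl => E; apply: (addIr (\sum_(k < n)
  lam (lift ord0 k) * r (lift ord0 k))); rewrite -E; congr (_ + _).
by apply: eq_bigr => k _; rewrite xl.
Qed.

Lemma dot_all_eq0 y : (forall i, dot y (a i) = 0) -> y = 0.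
Proof.
move=> y0; have uM : M^T \in unitmx by rewrite unitmx_tr -row_free_unit a_free.
apply: (can_inj (mulmxK uM)); rewrite mul0mx; apply/rowP => j.
rewrite [RHS]mxE -[RHS](y0 (lift ord0 j)) mxE dotE.
by apply: eq_bigr => k _; rewrite !mxE.
Qed.

Lemma height_inj x y : (forall i, f i x = f i y) -> x = y.
Proof.
move=> H; apply/eqP; rewrite -subr_eq0; apply/eqP; apply: dot_all_eq0 => i.
by move: (H i); rewrite /height dotBl => ?; lra.
Qed.

(** [B] is the constant value of the [lam]-weighted sum of heights, so [r0] is the one factor for
    which the heights [r0 * lam i] can occur together. *)
Let B := \sum_i lam i * b i.
Let r0 := B / \sum_i lam i ^+ 2.

Lemma sum_height x : \sum_i lam i * f i x = B.
Proof.
rewrite /height; under eq_bigr do rewrite mulrBr.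
by rewrite sumrB sum_lam_dot subr0.
Qed.

Let sumsq_gt0 : 0 < \sum_i lam i ^+ 2.
Proof.
rewrite big_ord_recl ltr_pwDl ?exprn_gt0 //.
by apply: sumr_ge0 => i _; rewrite exprn_ge0 // ltW.
Qed.

Let r0_gt0 : 0 < r0.
Proof.
apply: divr_gt0 => //; have [x ox] := interior.
rewrite -(sum_height x) big_ord_recl ltr_pwDl //.
  by rewrite mulr_gt0 // subr_gt0; apply: ox.
by apply: sumr_ge0 => i _; rewrite mulr_ge0 ?(ltW (lam_gt0 _)) // subr_ge0 ltW // ox.
Qed.

Lemma proportional_heights_exists : exists x, forall i, f i x = r0 * lam i.
Proof.
have [|x xE] := @dot_solve (fun i => b i - r0 * lam i).
  under eq_bigr do rewrite mulrBr [X in _ - X]mulrCA -expr2.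
  by rewrite sumrB -mulr_sumr divfK ?subrr ?gt_eqF.
by exists x => i; rewrite /height xE opprB addrC subrK.
Qed.

(** * The two colour classes and their common invariant line *)

Variable c : 'I_n.+1 -> bool.
Hypothesis c_orth : forall i j, i != j -> c i = c j -> dot (a i) (a j) = 0.

Let s d := [seq i <- enum 'I_n.+1 | c i == d].

Let s_uniq d : uniq (s d). Proof. by rewrite filter_uniq ?enum_uniq. Qed.

Let s_mem d i : (i \in s d) = (c i == d).
Proof. by rewrite mem_filter mem_enum andbT. Qed.

Let s_orth d : orth_seq a (s d).
Proof. by move=> i j; rewrite !s_mem => /eqP ci /eqP cj ij; rewrite c_orth // ci. Qed.

Let big_s d (V : nmodType) (F : 'I_n.+1 -> V) :
  \sum_(i <- s d) F i = \sum_(i | c i == d) F i.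
Proof. by rewrite big_filter big_enum_cond; apply: eq_bigl => i. Qed.

Let big_split_color (V : nmodType) (F : 'I_n.+1 -> V) :
  \sum_i F i = \sum_(i <- s false) F i + \sum_(i <- s true) F i.
Proof.
rewrite !big_s (bigID (fun i => c i == false)) /=; congr (_ + _).
by apply: eq_bigl => i; case: (c i).
Qed.

Let w0 := W (s false).
Let w1 := W (s true).

Let v := \sum_(i <- s false) lam i *: a i.

Let vE : v = - \sum_(i <- s true) lam i *: a i.
Proof. by apply/eqP; rewrite -addr_eq0 /v -big_split_color lam_rel. Qed.

Let dot_v i : dot v (a i) = if c i then - lam i else lam i.
Proof.
case ci: (c i); last by rewrite orth_sum // s_mem ci.
by rewrite vE dotNl orth_sum // s_mem ci.
Qed.

Let x0 := sval (cid proportional_heights_exists).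
Let x0E i : f i x0 = r0 * lam i.
Proof. by rewrite /x0; case: cid. Qed.

Definition axis_pt t := x0 + t *: v.

Lemma height_axis t i : f i (axis_pt t) = (if c i then r0 + t else r0 - t) * lam i.
Proof.
have := x0E i; rewrite /height /axis_pt dotDl dotZl opprD addrA => ->.
by rewrite dot_v; case: (c i); ring.
Qed.

(** All heights over the facets of colour [false] are the same multiple of [lam], so the
    displacements sum to a multiple of [v]. *)
Lemma w0_axis t : w0 (axis_pt t) = axis_pt (2 * r0 - t).
Proof.
rewrite /w0 word_orth // (eq_big_seq (fun i => (r0 - t) *: (lam i *: a i))).
  rewrite -scaler_sumr -/v scalerA /axis_pt -addrA -scalerDl; congr (_ + _ *: _).
  by ring.
by move=> i; rewrite s_mem => /eqP ci; rewrite height_axis ci scalerA.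
Qed.

Lemma w1_axis t : w1 (axis_pt t) = axis_pt (- 2 * r0 - t).
Proof.
rewrite /w1 word_orth // (eq_big_seq (fun i => (r0 + t) *: (lam i *: a i))).
  rewrite -scaler_sumr scalerA -[\sum_(i <- _) _]opprK -vE scalerN -scaleNr.
  rewrite /axis_pt -addrA -scalerDl; congr (_ + _ *: _).
  by ring.
by move=> i; rewrite s_mem => /eqP ci; rewrite height_axis ci scalerA.
Qed.

Let w0K : involutive w0. Proof. exact: word_orthK. Qed.
Let w1K : involutive w1. Proof. exact: word_orthK. Qed.

Let w1E y : w1 (w0 y) = w0 y + 2 *: \sum_(i <- s true) f i (w0 y) *: a i.
Proof. by rewrite /w1 word_orth. Qed.

Let w0E y : y = w0 y + 2 *: \sum_(i <- s false) f i (w0 y) *: a i.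
Proof. by rewrite -[LHS]w0K [LHS]word_orth. Qed.

(* All displacements have the same component along the axis, so those of axis
   points, which are parallel to it, are the shortest. *)
Lemma displacement_dot y : dot (w1 (w0 y) - y) v = - 2 * B.
Proof.
have E1 := w1E y; have E0 := w0E y; set y' := w0 y in E1 E0 *.
have H1 : dot (\sum_(i <- s true) f i y' *: a i) v =
          - \sum_(i <- s true) lam i * f i y'.
  rewrite dot_suml -sumrN; apply: eq_big_seq => i; rewrite s_mem => /eqP ci.
  by rewrite dotZl dotC dot_v ci; ring.
have H0 : dot (\sum_(i <- s false) f i y' *: a i) v =
          \sum_(i <- s false) lam i * f i y'.
  rewrite dot_suml; apply: eq_big_seq => i; rewrite s_mem => /eqP ci.
  by rewrite dotZl dotC dot_v ci; ring.
rewrite E1 E0 dotBl !dotDl !dotZl H0 H1 -(sum_height y') big_split_color.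
by ring.
Qed.

(** The point reflections of the parameter at [r0] and then at [- r0] compose to a shift by
    [- 4 * r0]. *)
Let d := (- 4 * r0) *: v.

Let axis_displacement t : w1 (w0 (axis_pt t)) - axis_pt t = d.
Proof.
rewrite w0_axis w1_axis /axis_pt (opprD x0) addrACA subrr add0r -scalerBl.
by congr (_ *: _); ring.
Qed.

Let displacement_pythagoras y : let z := w1 (w0 y) - y in
  dot z z = dot (z - d) (z - d) + dot d d.
Proof.
move=> z; have zv : dot z v = dot d v.
  by rewrite displacement_dot -(axis_displacement 0) displacement_dot.
have : dot (z - d) d = 0 by rewrite {2}/d dotZr dotBl zv subrr mulr0.
clearbody z; clear zv.
by rewrite !(dotBl, dotBr) (dotC d z) => ?; lra.
Qed.

Lemma min_set_axis y : min_set (w1 \o w0) y <-> exists t, y = axis_pt t.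
Proof.
split=> [miny|[t ->] z /=]; last first.
  by rewrite axis_displacement [leRHS]displacement_pythagoras lerDr dot_ge0.
have zd : w1 (w0 y) - y = d.
  apply/eqP; rewrite -subr_eq0; apply/eqP; apply: dot_eq0.
  have := miny (axis_pt 0); rewrite /= axis_displacement displacement_pythagoras.
  by rewrite gerDr => le0; apply/eqP; rewrite eq_le le0 dot_ge0.
have E1 := w1E y; have E0 := w0E y; set y' := w0 y in zd E1 E0.
(* The equation [zd], divided by 2 and with [v] expanded over the colour [false], is a linear
   relation between the normals with these coefficients. *)
pose k i := if c i then f i y' else 2 * r0 * lam i - f i y'.
have [|kappa kE] := @relation_unique k.
  rewrite big_split_color.
  have -> : \sum_(i <- s true) k i *: a i = \sum_(i <- s true) f i y' *: a i.
    by apply: eq_big_seq => i; rewrite s_mem /k => /eqP ->.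
  have -> : \sum_(i <- s false) k i *: a i =
      (2 * r0) *: v - \sum_(i <- s false) f i y' *: a i.
    rewrite /v scaler_sumr -sumrB; apply: eq_big_seq => i; rewrite s_mem /k => /eqP ->.
    by rewrite scalerA -scalerBl.
  have two : (2 : R) != 0 by rewrite pnatr_eq0.
  apply: (scalerI two); rewrite scaler0 scalerDr scalerBr scalerA.
  move: zd; rewrite E1 [X in _ - X]E0 (opprD y') addrACA subrr add0r /d.
  move/eqP; rewrite -subr_eq0 => /eqP H; rewrite -[RHS]H.
  have -> : (2 * (2 * r0)) *: v = - ((-4 * r0) *: v).
    by rewrite -[RHS]scaleNr; congr (_ *: _); ring.
  move: (- (_ *: v)) (2 *: _) (2 *: _) => p q r.
  by rewrite -addrA [RHS]addrC [r - q]addrC.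
(* By [kE], [y'] has the heights of the axis point with parameter [kappa - r0], which [w0] sends to
   [3 * r0 - kappa]. *)
exists (3 * r0 - kappa); apply: height_inj => i; rewrite height_axis E0.
rewrite /height dotDl dotZl.
have -> : \sum_(i <- s false) f i y' *: a i = (2 * r0 - kappa) *: v.
  rewrite /v scaler_sumr; apply: eq_big_seq => j; rewrite s_mem => /eqP cj.
  by rewrite scalerA; congr (_ *: _); have := kE j; rewrite /k cj => ?; lra.
rewrite dotZl dot_v; have := kE i; rewrite /k /height.
by case: (c i) => ?; lra.
Qed.

Lemma open_axis t : `|t| < r0 -> open_simplex a b (axis_pt t).
Proof.
rewrite ltr_norml => /andP [t1 t2] i; rewrite -subr_gt0 -[_ - _]/(f i _).
by rewrite height_axis mulr_gt0 //; case: (c i); lra.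
Qed.

Lemma closed_axis t : `|t| <= r0 -> closed_simplex a b (axis_pt t).
Proof.
rewrite ler_norml => /andP [t1 t2] i; rewrite -subr_ge0 -[_ - _]/(f i _).
by rewrite height_axis mulr_ge0 ?(ltW (lam_gt0 _)) //; case: (c i); lra.
Qed.

Lemma min_set_open : exists2 x, open_simplex a b x & min_set (w1 \o w0) x.
Proof.
exists (axis_pt 0); first by apply: open_axis; rewrite normr0.
by apply/min_set_axis; exists 0.
Qed.

(** Conjugation by [g] fixes or exchanges the two products. Both are recorded because composing with
    [w0] or [w1] turns one case into the other. *)
Definition preserves_or_swaps (g : 'rV[R]_n -> 'rV[R]_n) :=
  (forall x, g (w1 (w0 x)) = w1 (w0 (g x)) /\
             g (w0 (w1 x)) = w0 (w1 (g x))) \/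
  (forall x, g (w1 (w0 x)) = w0 (w1 (g x)) /\
             g (w0 (w1 x)) = w1 (w0 (g x))).

(** A parameter above [r0] is reflected at [r0] by [w0], one below [- r0] at [- r0] by [w1]; each
    fold lowers the bound by [2 * r0]. *)
Let axis_folding k t : `|t| <= r0 + 2 * r0 * k%:R ->
  exists2 g, closed_simplex a b (W g (axis_pt t)) & preserves_or_swaps (W g).
Proof.
elim: k t => [|k IH] t.
  rewrite mulr0 addr0 => tr; exists [::]; first exact: closed_axis.
  by left=> x.
rewrite -addn1 natrD ler_norml => /andP [t1 t2].
have rk : 0 <= r0 * k%:R by rewrite mulr_ge0 ?(ltW r0_gt0).
case: (leP t r0) => tr; last first.
  have [|g cg Qg] := IH (2 * r0 - t); first by rewrite ler_norml; apply/andP; lra.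
  exists (g ++ s false); first by rewrite word_cat -/w0 w0_axis.
  case: Qg => Qg; [right|left] => x; rewrite !word_cat -/w0;
    have [Q1 Q2] := Qg (w0 x); rewrite -Q1 -Q2; split; congr (W g _);
    by rewrite ?w0K.
case: (leP (- r0) t) => tr'.
  exists [::]; last by left=> x.
  by apply: closed_axis; rewrite ler_norml tr' tr.
have [|g cg Qg] := IH (- 2 * r0 - t); first by rewrite ler_norml; apply/andP; lra.
exists (g ++ s true); first by rewrite word_cat -/w1 w1_axis.
case: Qg => Qg; [right|left] => x; rewrite !word_cat -/w1;
  have [Q1 Q2] := Qg (w1 x); rewrite -Q1 -Q2; split; congr (W g _);
  by rewrite ?w1K.
Qed.

Lemma min_set_folding x : min_set (w1 \o w0) x ->
  exists2 g, closed_simplex a b (W g x) & preserves_or_swaps (W g).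
Proof.
move=> /min_set_axis [t ->]; apply: (@axis_folding (Num.truncn (`|t| / r0)).+1).
have /andP [_ H] := truncn_itv (divr_ge0 (normr_ge0 t) (ltW r0_gt0)).
have := ltW H; rewrite ler_pdivrMr // => H'; apply: le_trans H' _.
rewrite -mulrA; have : 0 <= r0 * (Num.truncn (`|t| / r0)).+1%:R.
  by rewrite mulr_ge0 ?(ltW r0_gt0).
by rewrite mulrC; have := r0_gt0; lra.
Qed.

End Axis.

(** * Every Coxeter element is bipartite for some chamber *)

(** The cosine vanishes for [m i j = 2] and is positive for larger values. Symmetry of the diagram
    then follows from that of [dot]. *)
Lemma diagram_dot (R : realType) (n : nat) (a : 'I_n.+1 -> 'rV[R]_n)
  (m : 'I_n.+1 -> 'I_n.+1 -> nat) :
  (forall i j, i != j ->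
     (2 <= m i j)%N /\ dot (a i) (a j) = - cos (pi / (m i j)%:R)) ->
  forall i j, diagram m i j = (i != j) && (dot (a i) (a j) != 0).
Proof.
move=> a_angle i j; rewrite /diagram.
have [//|ij /=] := eqVneq i j; case: (a_angle i j ij) => m2 ->.
rewrite oppr_eq0 leq_eqVlt in m2 *; case/orP: m2 => [/eqP <-|m3].
  by rewrite cos_pihalf eqxx.
rewrite m3 gt_eqF // cos_gt0_pihalf //; have pi0 := pi_gt0 R.
have m0 : 0 < (m i j)%:R :> R by rewrite ltr0n; apply: leq_trans m3.
have q0 : 0 < pi / (m i j)%:R :> R by rewrite divr_gt0.
apply/andP; split; first by apply: lt_trans q0; rewrite oppr_lt0 divr_gt0.
by rewrite ltr_pM2l // ltf_pV2 ?posrE // ltr_nat.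
Qed.

Lemma coxeter_element_bipartite (R : realType) (n : nat)
  (a : 'I_n.+1 -> 'rV[R]_n) (b : 'I_n.+1 -> R)
  (m : 'I_n.+1 -> 'I_n.+1 -> nat) (w : 'rV[R]_n -> 'rV[R]_n) :
  (forall i, dot (a i) (a i) = 1) ->
  (forall i j, i != j ->
     (2 <= m i j)%N /\ dot (a i) (a j) = - cos (pi / (m i j)%:R)) ->
  is_tree (diagram m) -> is_coxeter_element a b w ->
  exists (c : 'I_n.+1 -> bool) (u : seq 'I_n.+1),
    (forall i j, diagram m i j -> c i != c j) /\
    w = color_prod a b u c true \o color_prod a b u c false.
Proof.
move=> a_unit a_angle [_ acyclic] [u [p wE]].
have dd := diagram_dot a_angle.
have e_sym : symmetric (diagram m) by move=> i j; rewrite !dd eq_sym dotC.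
have e_irr : irreflexive (diagram m) by move=> i; rewrite dd eqxx.
have [c cP] := exists_coloring e_sym e_irr acyclic (enum_uniq 'I_n.+1).
pose s d := [seq i <- enum 'I_n.+1 | c i == d].
have sm d i : (i \in s d) = (c i == d) by rewrite mem_filter mem_enum andbT.
have us : uniq (map p (enum 'I_n.+1)) by rewrite (map_inj_uniq perm_inj) enum_uniq.
have perm_s : perm_eq (map p (enum 'I_n.+1)) (s true ++ s false).
  apply: uniq_perm => //.
  - have su d : uniq (s d) by rewrite filter_uniq // enum_uniq.
    rewrite cat_uniq !su andbT /=.
    by apply/hasPn => i; rewrite !sm => /eqP ->.
  - move=> i; rewrite mem_cat !sm.
    rewrite -[i in LHS](permKV p) (mem_map perm_inj) mem_enum.
    by case: (c i).
have [|h hE] := cox_move_conj b a_unit _ (cox_move_perm e_sym e_irr acyclic us perm_s).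
  by move=> i j ij; rewrite dd ij negbK => /eqP.
(* The conjugator [h] is absorbed into the chamber: relative to [u ++ h] the same isometry is sorted
   by colour. *)
exists c, (u ++ h); split.
  by move=> i j eij; apply: cP; rewrite ?mem_enum.
apply/funext => x; rewrite wE /= !color_prodE // word_revK // -/(s true) -/(s false).
have -> : foldr (fun k f => facet_refl a b u (p k) \o f) id (enum 'I_n.+1) x =
  foldr (fun k f => facet_refl a b u k \o f) id (map p (enum 'I_n.+1)) x.
  by elim: (enum _) => //= k l ->.
rewrite facet_word // rev_cat !word_cat; congr (word_eval a b u _).
by rewrite -(word_cat a b (s true)) -hE word_Krev.
Qed.

Theorem theorem8p10 (R : realType) (n : nat)
  (a : 'I_n.+1 -> 'rV[R]_n) (b : 'I_n.+1 -> R)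
  (m : 'I_n.+1 -> 'I_n.+1 -> nat) :
  is_simplex a b ->
  (forall i, dot (a i) (a i) = 1) ->
  (forall i j, i != j ->
     (2 <= m i j)%N /\ dot (a i) (a j) = - cos (pi / (m i j)%:R)) ->
  is_tree (diagram m) ->
  forall w : 'rV[R]_n -> 'rV[R]_n,
  is_coxeter_element a b w ->
  forall u : seq 'I_n.+1,
    produces_bipartite a b m u w <->
    (exists x, min_set w x /\ chamber_interior a b u x).
Proof.
move=> [a_free [lam [lam_gt0 lam_rel]] int] a_unit a_angle tree w cox u.
have c_orth (c : 'I_n.+1 -> bool) : (forall i j, diagram m i j -> c i != c j) ->
    forall i j, i != j -> c i = c j -> dot (a i) (a j) = 0.
  move=> cP i j ij cij; apply/eqP; apply: contraT => d0.
  by have := cP i j; rewrite (diagram_dot a_angle) ij d0 cij eqxx; apply.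
pose s (c : 'I_n.+1 -> bool) d := [seq i <- enum 'I_n.+1 | c i == d].
have prodE u' c d d' : color_prod a b u' c d \o color_prod a b u' c d' =
    fun x => word_eval a b u' ((word_eval a b (s c d) \o word_eval a b (s c d'))
               (word_eval a b (rev u') x)).
  by apply/funext => x /=; rewrite !color_prodE // word_revK.
have prodN u' c d : color_prod a b u' (negb \o c) d = color_prod a b u' c (~~ d).
  congr (foldr _ _ _); apply: eq_filter => i /=.
  by case: (c i); case: d.
split.
  move=> [c0 [c0P c0w]].
  have [c [cP ->]] : exists c : 'I_n.+1 -> bool,
      (forall i j, diagram m i j -> c i != c j) /\
      w = color_prod a b u c true \o color_prod a b u c false.
    case: c0w => ->; first by exists c0.
    (* Exchanging the colours reverses the order of the two factors. *)
    exists (negb \o c0); rewrite !prodN; split=> // i j /c0P.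
    by rewrite /=; case: (c0 i); case: (c0 j).
  have [x ox minx] := min_set_open a_unit a_free lam_gt0 lam_rel int (c_orth c cP).
  exists (word_eval a b u x); split; last by exists x.
  by rewrite prodE min_set_conj.
move=> [x [minx [y oy xE]]].
have [c [u1 [cP wE]]] := coxeter_element_bipartite a_unit a_angle tree cox.
exists c; split=> //.
move: minx; rewrite {1}wE prodE -[x](word_Krev b a_unit u1) min_set_conj //.
(* Pulled back by [u1], the point lies on the axis for the base chamber and folds by [g] into the
   closed simplex. It is also the image of the interior point [y] under [g], the inverse of [u1] and
   [u], so this composite is the identity. *)
case/(min_set_folding a_unit a_free lam_gt0 lam_rel int (c_orth c cP)) => g.
rewrite xE -!word_cat => /(word_simply_transitive a_unit a_angle oy) guE Qg.
have gK z : word_eval a b (rev g) (word_eval a b g z) = z by rewrite word_revK.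
have u_g z : word_eval a b u z =
             word_eval a b u1 (word_eval a b (rev g) z).
  by rewrite -[z in RHS]guE !word_cat gK word_Krev.
have ru_g z : word_eval a b (rev u) z =
              word_eval a b g (word_eval a b (rev u1) z).
  by have := guE (word_eval a b (rev u) z); rewrite !word_cat word_Krev.
(* As isometries [u] is [u1] times the inverse of [g]; whether [g] preserves or swaps the products
   decides the order of the factors. *)
case: Qg => Qg; [left|right]; rewrite wE !prodE; apply/funext => z.
  by rewrite u_g ru_g /= -(proj1 (Qg _)) gK.
by rewrite u_g ru_g /= -(proj1 (Qg _)) gK.
Qed.
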